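(* Let $p$ be an odd prime and let $G$ be a (finite) powerful $p$-group. Then the subgroups $\chi(G)'$ and $D(G)$ are powerfully embedded in $\chi(G)$.
   Context: For a group $G$, let $\varphi: G\to G^{\varphi}$, $g\mapsto g^{\varphi}$, be an isomorphism onto a copy $G^{\varphi}$ of $G$. The weak commutativity group of $G$ is $$\chi(G)=\langle G\cup G^{\varphi}\mid [g,g^{\varphi}]=1,\ \forall g\in G\rangle,$$ where the relations of $G$ and of $G^{\varphi}$ are also understood to hold (so $\chi(G)$ is a quotient of the free product $G*G^{\varphi}$). $D(G)=[G,G^{\varphi}]$ is the subgroup of $\chi(G)$ generated by all $[g,h^{\varphi}]$ with $g,h\in G$, and $\chi(G)'=[\chi(G),\chi(G)]$. For a $p$-group $H$, $H^p$ denotes the subgroup generated by all $h^p$, $h\in H$, and $H'=[H,H]$. For $p$ odd, a finite $p$-group $H$ is powerful if $H'\leqslant H^p$, and a subgroup $N$ of a finite $p$-group $H$ is powerfully embedded in $H$ if $[N,H]\leqslant N^p$. *)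

(* Defs.v *)
From HB Require Import structures.
From mathcomp Require Import all_boot fingroup pgroup.
From mathcomp Require Import generic_quotient boolp classical_sets.

Set Implicit Arguments.
Unset Strict Implicit.
Unset Printing Implicit Defensive.

Local Open Scope classical_set_scope.
Local Open Scope quotient_scope.
Local Open Scope group_scope.

Section Subgroups.
Variable G : groupType.
Implicit Types (A B H N : set G) (p : nat).

Definition is_subgroup H : Prop :=
  [/\ H 1, (forall x y, H x -> H y -> H (x * y)) &
      (forall x, H x -> H x^-1)].

Definition generated A : set G := smallest is_subgroup A.

Definition commutator_subgroup A B : set G :=
  generated [set [~ x, y] | x in A & y in B].

Definition power_subgroup p A : set G := generated [set x ^+ p | x in A].

(* [p.-group] is only available for subsets of a [finGroupType], so a
   possibly infinite group is compared with one by an isomorphism. *)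
Definition finite_pgroup p : Prop :=
  exists (F : finGroupType) (f : {multiplicative F -> G}),
    bijective f /\ p.-group [set: F]%SET.

(* The conditions below are the usual ones for odd p only. *)
Definition powerful p : Prop :=
  finite_pgroup p /\
  commutator_subgroup [set: G] [set: G] `<=` power_subgroup p [set: G].

Definition powerfully_embedded p N : Prop :=
  [/\ finite_pgroup p, is_subgroup N &
      commutator_subgroup N [set: G] `<=` power_subgroup p N].

End Subgroups.

Arguments finite_pgroup : clear implicits.
Arguments powerful : clear implicits.

Section WeakCommutativity.
Variable G : groupType.

(* Words in the elements of G and of its copy: (false, g) stands for g and
   (true, g) for its image under the isomorphism with the copy. *)
Definition chi_word : Type := seq (bool * G).
HB.instance Definition _ := Choice.on chi_word.

(* The congruence on words generated by the multiplication tables of G and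
   of its copy, and by the commutation of g with its image. Since inverses
   already exist in G, this monoid presentation presents a group. *)
Inductive chi_cong : chi_word -> chi_word -> Prop :=
| chi_cong_refl u : chi_cong u u
| chi_cong_sym u v : chi_cong u v -> chi_cong v u
| chi_cong_trans u v w : chi_cong u v -> chi_cong v w -> chi_cong u w
| chi_cong_cat u u' v v' :
    chi_cong u u' -> chi_cong v v' -> chi_cong (u ++ v) (u' ++ v')
| chi_cong_one b : chi_cong [:: (b, 1)] [::]
| chi_cong_mul b x y : chi_cong [:: (b, x); (b, y)] [:: (b, x * y)]
| chi_cong_comm g :
    chi_cong [:: (false, g); (true, g)] [:: (true, g); (false, g)].

Definition chi_rel : rel chi_word := fun u v => `[< chi_cong u v >].

Fact chi_rel_refl : reflexive chi_rel.
Proof. by move=> u; apply/asboolP; exact: chi_cong_refl. Qed.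

Fact chi_rel_sym : symmetric chi_rel.
Proof. by move=> u v; apply/asboolP/asboolP; exact: chi_cong_sym. Qed.

Fact chi_rel_trans : transitive chi_rel.
Proof.
move=> v u w /asboolP uv /asboolP vw; apply/asboolP.
exact: chi_cong_trans uv vw.
Qed.

Canonical chi_equiv := EquivRel chi_rel chi_rel_refl chi_rel_sym chi_rel_trans.

Definition chi : Type := {eq_quot chi_equiv}.
HB.instance Definition _ := Choice.on chi.

Definition chi_pi (u : chi_word) : chi := \pi_{eq_quot chi_equiv} u.

Lemma chi_piP u v : chi_pi u = chi_pi v <-> chi_cong u v.
Proof.
split; first by move=> /eqquotP/asboolP.
by move=> uv; apply/eqquotP/asboolP.
Qed.

Lemma chi_reprK (x : chi) : chi_pi (repr (x : {eq_quot chi_equiv})) = x.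
Proof. exact: reprK. Qed.

Lemma chi_repr_cong u :
  chi_cong (repr (chi_pi u : {eq_quot chi_equiv})) u.
Proof. by apply/chi_piP; rewrite chi_reprK. Qed.

Definition word_inv (u : chi_word) : chi_word :=
  rev [seq (a.1, a.2^-1) | a <- u].

Definition chi_one : chi := chi_pi [::].
Definition chi_mul (x y : chi) : chi :=
  chi_pi (repr (x : {eq_quot chi_equiv}) ++ repr (y : {eq_quot chi_equiv})).
Definition chi_inv (x : chi) : chi :=
  chi_pi (word_inv (repr (x : {eq_quot chi_equiv}))).

Lemma chi_mulE u v : chi_mul (chi_pi u) (chi_pi v) = chi_pi (u ++ v).
Proof. by apply/chi_piP/chi_cong_cat; exact: chi_repr_cong. Qed.

Lemma word_mulV u : chi_cong (u ++ word_inv u) [::].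
Proof.
elim: u => [|[b x] u IHu]; first exact: chi_cong_refl.
have -> : ((b, x) :: u) ++ word_inv ((b, x) :: u)
          = [:: (b, x)] ++ (u ++ word_inv u) ++ [:: (b, x^-1)].
  by rewrite /word_inv /= rev_cons -cats1 !catA.
apply: (chi_cong_trans (v := [:: (b, x)] ++ [::] ++ [:: (b, x^-1)])).
  apply: chi_cong_cat; first exact: chi_cong_refl.
  by apply: chi_cong_cat; [exact: IHu | exact: chi_cong_refl].
apply: chi_cong_trans (chi_cong_mul _ _ _) _.
by rewrite mulgV; exact: chi_cong_one.
Qed.

Lemma word_invK : involutive word_inv.
Proof.
move=> u; rewrite /word_inv map_rev revK -map_comp -[RHS]map_id.
by apply: eq_map => -[b x] /=; rewrite invgK.
Qed.

Lemma word_mulVl u : chi_cong (word_inv u ++ u) [::].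
Proof. by rewrite -{2}[u]word_invK; exact: word_mulV. Qed.

Lemma chi_mulA : associative chi_mul.
Proof.
move=> x y z; rewrite -[x]chi_reprK -[y]chi_reprK -[z]chi_reprK.
by rewrite !chi_mulE catA.
Qed.

Lemma chi_mul1 : left_id chi_one chi_mul.
Proof. by move=> x; rewrite -[x]chi_reprK chi_mulE. Qed.

Lemma chi_mulr1 : right_id chi_one chi_mul.
Proof. by move=> x; rewrite -[x]chi_reprK chi_mulE cats0. Qed.

Lemma chi_mulV : left_inverse chi_one chi_inv chi_mul.
Proof.
move=> x; rewrite -[X in chi_mul _ X]chi_reprK chi_mulE.
exact/chi_piP/word_mulVl.
Qed.

Lemma chi_mulrV : right_inverse chi_one chi_inv chi_mul.
Proof.
move=> x; rewrite -[X in chi_mul X _]chi_reprK chi_mulE.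
exact/chi_piP/word_mulV.
Qed.

HB.instance Definition _ :=
  isGroup.Build chi chi_mulA chi_mul1 chi_mulr1 chi_mulV chi_mulrV.

Definition chi_in (b : bool) (g : G) : chi := chi_pi [:: (b, g)].

(* The canonical maps to chi of G and of its copy. *)
Definition chi_g : G -> chi := chi_in false.
Definition chi_phi : G -> chi := chi_in true.

Lemma chi_pi_cat u v : chi_pi (u ++ v) = chi_pi u * chi_pi v.
Proof. exact/esym/chi_mulE. Qed.

Lemma chi_gM : {morph chi_g : x y / x * y}.
Proof.
by move=> x y; rewrite -chi_pi_cat; apply/chi_piP/chi_cong_sym/chi_cong_mul.
Qed.

Lemma chi_phiM : {morph chi_phi : x y / x * y}.
Proof.
by move=> x y; rewrite -chi_pi_cat; apply/chi_piP/chi_cong_sym/chi_cong_mul.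
Qed.

HB.instance Definition _ := isMultiplicative.Build G chi chi_g chi_gM.
HB.instance Definition _ := isMultiplicative.Build G chi chi_phi chi_phiM.

Lemma chi_commute g : commute (chi_g g) (chi_phi g).
Proof.
by rewrite /commute -!chi_pi_cat; apply/chi_piP/chi_cong_comm.
Qed.

(* chi satisfies the universal property of the defining presentation. *)
Lemma chi_universal (K : groupType) (f h : {multiplicative G -> K}) :
  (forall g, commute (f g) (h g)) ->
  exists! u : chi -> K,
    [/\ {morph u : x y / x * y}, u \o chi_g =1 f & u \o chi_phi =1 h].
Proof.
move=> fh; pose e (a : bool * G) : K := if a.1 then h a.2 else f a.2.
pose ev (w : chi_word) : K := foldr (fun a k => e a * k) 1 w.
have k1 (k : {multiplicative G -> K}) : k 1 = 1.
  by apply: (mulgI (k 1)); rewrite -gmulfM !mulg1.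
have ev_cat w1 w2 : ev (w1 ++ w2) = ev w1 * ev w2.
  by elim: w1 => [|a w1 IH] /=; rewrite ?mul1g // IH mulgA.
have ev_cong w1 w2 : chi_cong w1 w2 -> ev w1 = ev w2.
  elim=> {w1 w2} //.
  - by move=> w1 w2 w3 _ -> _ ->.
  - by move=> w1 w2 w3 w4 _ E1 _ E2; rewrite !ev_cat E1 E2.
  - by case; rewrite /= mulg1; exact: k1.
  - by case=> x y; rewrite /= !mulg1 /e /= gmulfM.
  - by move=> g; rewrite /= !mulg1; exact: fh.
pose u (x : chi) : K := ev (repr (x : {eq_quot chi_equiv})).
have uE w : u (chi_pi w) = ev w by apply: ev_cong; exact: chi_repr_cong.
exists u; split.
  split=> [x y|g|g] /=; last 2 first.
  - by rewrite uE /= mulg1.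
  - by rewrite uE /= mulg1.
  by rewrite -[x]chi_reprK -[y]chi_reprK -chi_pi_cat !uE ev_cat.
move=> v [vM vg vphi]; apply/funext => x; rewrite -[x]chi_reprK uE.
have v1 : v 1 = 1 by apply: (mulgI (v 1)); rewrite -vM !mulg1.
elim: (repr _) => [|[[] g] w IHw] /=; first exact: esym v1.
- by rewrite -cat1s chi_pi_cat vM IHw /e /= -vphi.
- by rewrite -cat1s chi_pi_cat vM IHw /e /= -vg.
Qed.

Definition chi_D : set chi :=
  generated [set [~ chi_g g, chi_phi h] | g in [set: G] & h in [set: G]].

Definition chi_derived : set chi :=
  commutator_subgroup [set: chi] [set: chi].

End WeakCommutativity.

Arguments chi_D : clear implicits.
Arguments chi_derived : clear implicits.

(* Main.v *)
(** The two copies of G act in the same way by conjugation on every commutator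
    [g, h^phi] (weak_comm_conj), and [g, h^phi] = [g^phi, h].

    chi(G) is a finite p-group by induction on |G|.  Let z be central in G and
    u(h) = [z, h^phi].  As zh = hz, comparing u(zh) = u(h) with
    u(hz) = u(h)^(z^phi) shows that z centralises u(h), so that u(h)^|z| = 1.
    The normal closure of z and z^phi is therefore generated by the finitely
    many commuting elements z, z^phi, u(h) of order dividing |z|; it is the
    kernel of chi(G) -> chi(G/<z>).

    By nilpotency, N is powerfully embedded as soon as N is central in every
    quotient in which N^p = [N, chi, chi] = 1.  For N = D(G), the function
    f(g, k, h) = [[g, h^phi], k] of such a quotient is symmetric in (g, k),
    because G' <= G^p yields [[g, k], h^phi] = 1, and antisymmetric in (g, h);
    hence f^2 = 1 and f = 1.  For N = chi(G)', the quotient by N^p makes D(G)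
    central, so that [x^p, h^phi] = [x, h^phi]^p = 1 and G' is centralised by
    the copy of G; it is central in G because G' is powerfully embedded in G. *)
From HB Require Import structures.
Require Import Defs.
From mathcomp Require Import generic_quotient boolp classical_sets.
From mathcomp Require Import all_boot all_fingroup all_solvable.

Set Implicit Arguments.
Unset Strict Implicit.
Unset Printing Implicit Defensive.

Local Open Scope group_scope.

Lemma commgM_conj (T : groupType) (x y z : T) :
  [~ x, y * z] = [~ x, z] * [~ x, y] ^ z.
Proof. by rewrite !commgEl conjgM -mulgA -conjMg mulVKg. Qed.

(** * Commutators between two homomorphisms that commute elementwise *)

Section WeaklyCommuting.
Variables (G T : groupType) (a b : UMagmaMorphism.type G T).
Hypothesis ab_comm : forall g, commute (a g) (b g).

(** Multiply the commutation relation of [x * y^-1] by the inverse of that of [x] on the left and by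
    that of [y] on the right; all but the two commutators cancels. *)
Lemma weak_comm_swap x y : [~ a x, b y] = [~ b x, a y].
Proof.
have E := ab_comm (x * y^-1).
rewrite /commute !gmulfM !gmulfV in E.
have {}E : (a x * b x)^-1 * (a x * (a y)^-1 * (b x * (b y)^-1)) * (b y * a y) =
  (b x * a x)^-1 * (b x * (b y)^-1 * (a x * (a y)^-1)) * (a y * b y).
  by rewrite E (ab_comm x) (ab_comm y).
rewrite !invgM !mulgA !mulgVK in E.
by rewrite /commg /conjg !mulgA E.
Qed.

(** Expanding [[~ a x, b (y * k)]] and its equal [[~ b x, a (y * k)]] by [commgM_conj] gives
    products that differ only in the conjugating element. *)
Lemma weak_comm_conj x y k : [~ a x, b y] ^ a k = [~ a x, b y] ^ b k.
Proof.
apply: (mulgI [~ a x, b k]); rewrite -commgM_conj -gmulfM !weak_comm_swap.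
by rewrite gmulfM commgM_conj.
Qed.

Let weakly_fixed d := forall k, d ^ a k = d ^ b k.

Let weakly_fixedJ d m : weakly_fixed d -> weakly_fixed (d ^ a m).
Proof.
by move=> fd k; have := fd (m * k); rewrite !gmulfM !conjgM -(fd m).
Qed.

(** Conjugation by [[~ a x, b y]] conjugates by four letters in turn. Each intermediate conjugate is
    still weakly fixed, so letters from [b] may be exchanged for letters from [a]. *)
Lemma weak_comm_conj_comm g h x y :
  [~ a g, b h] ^ [~ a x, b y] = [~ a g, b h] ^ a [~ x, y].
Proof.
have fd : weakly_fixed [~ a g, b h] := weak_comm_conj g h.
have JR (d u v : T) : d ^ [~ u, v] = (((d ^ u^-1) ^ v^-1) ^ u) ^ v.
  by rewrite -!conjgM.
rewrite gmulfR !JR -!gmulfV.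
have fxV := weakly_fixedJ x^-1 fd; have fyV := weakly_fixedJ y^-1 fxV.
by rewrite -fxV (weakly_fixedJ x fyV).
Qed.

Section Central.
Variables (z : G) (m : nat).
Hypotheses (cz : forall g, commute z g) (zm : z ^+ m = 1).

Let u h := [~ a z, b h].

Lemma weak_comm_central_fix h : commute (u h) (a z) /\ commute (u h) (b z).
Proof.
suff cb : commute (u h) (b z).
  split=> //; apply/commgP; rewrite -conjg_fix.
  by rewrite /u weak_comm_conj conjg_fix; apply/commgP.
have uz : u z = 1 by apply/eqP/commgP.
apply/commgP; rewrite -conjg_fix; apply/eqP.
rewrite -[LHS]mul1g -{1}uz /u -commgM_conj -gmulfM -(cz h) gmulfM commgM_conj.
by move: uz; rewrite /u => ->; rewrite conj1g mulg1.
Qed.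

(** In [a z ^ b h = a z * u h] the left side has [m]-th power 1 and the factors on the right
    commute. *)
Lemma weak_comm_central_exp h : u h ^+ m = 1.
Proof.
have [ca _] := weak_comm_central_fix h.
have: (a z ^+ m) ^ b h = 1 by rewrite -gmulfXn zm gmulf1 conj1g.
rewrite conjXg -[a z ^ b h](mulVKg (a z)) -commgEl expgMn //.
by rewrite -gmulfXn zm gmulf1 mul1g.
Qed.

(** [u h] acts on [u g] as [a [~ z, h]], and [[~ z, h] = 1]. *)
Lemma weak_comm_central_comm g h : commute (u g) (u h).
Proof.
apply/commgP; rewrite -conjg_fix weak_comm_conj_comm.
by have /commgP/eqP -> := cz h; rewrite gmulf1 conjg1.
Qed.

Lemma weak_comm_central_conj h k : u h ^ a k = (u k)^-1 * u (h * k).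
Proof.
by rewrite weak_comm_conj // /u gmulfM commgM_conj mulKg.
Qed.

End Central.
End WeaklyCommuting.

(** * Generated subgroups; finiteness in the abelian case of bounded exponent *)

Section Generated.
Variable T : groupType.
Implicit Types (A : set T) (s t : seq T).

Lemma generated_subgroup A : is_subgroup (Defs.generated A).
Proof.
split=> [H [[] //]|x y Ax Ay H HA|x Ax H HA].
- by have [[_ HM _] _] := HA; apply: HM; [apply: Ax | apply: Ay].
- by have [[_ _ HV] _] := HA; apply: HV; apply: Ax.
Qed.

Lemma mem_generated A x : A x -> Defs.generated A x.
Proof. by move=> Ax H [_]; apply. Qed.

Lemma generated_min A H :
  is_subgroup H -> (forall x, A x -> H x) ->
  forall x, Defs.generated A x -> H x.
Proof. by move=> sgH AH x; apply. Qed.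

Lemma abelian_generated_finite m s :
    0 < m -> {in s &, forall x y, commute x y} ->
    (forall x, x \in s -> x ^+ m = 1) ->
  exists t, forall x,
    Defs.generated (fun x => x \in s) x -> x \in t /\ x ^+ m = 1.
Proof.
move=> m_gt0 cs sm.
(* The list is built one generator at a time. The last clause ensures that the next generator
   commutes with the list built so far. *)
suff [t [t1 tM st tm _]] : exists t, [/\ 1 \in t,
    (forall x y, x \in t -> y \in t -> x * y \in t), {subset s <= t},
    (forall x, x \in t -> x ^+ m = 1) &
    forall c, (forall x, x \in s -> commute c x) ->
      forall x, x \in t -> commute c x].
  exists t => x gx; suff xt : x \in t by split=> //; exact: tm.
  apply: (generated_min (H := fun x => x \in t) _ _ gx) => //.
  (* Closure under products suffices, as inverses are [m.-1]-th powers. *)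
  split=> //= y yt; have -> : y^-1 = y ^+ m.-1.
    by apply/mulg1_eq; rewrite -expgS prednK // tm.
  by elim: m.-1 => [|n IHn]; rewrite ?expg0 // expgS tM.
elim: s cs sm => [|x s IHs] cs sm.
  exists [:: 1]; split=> [|y w|//|y|c _ y]; rewrite ?inE //.
  - by move=> /eqP-> /eqP->; rewrite mulg1.
  - by move/eqP->; rewrite expg1n.
  - by move/eqP->; exact: commute1.
have [||t [t1 tM st tm tc]] := IHs.
- by move=> y w ys ws; apply: cs; rewrite inE ?ys ?ws orbT.
- by move=> y ys; apply: sm; rewrite inE ys orbT.
have xm : x ^+ m = 1 by apply: sm; rewrite mem_head.
have cx y : y \in t -> commute x y.
  by apply: tc => w ws; apply: cs; rewrite inE ?eqxx ?ws ?orbT.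
have memt i y :
    y \in t -> x ^+ i * y \in [seq x ^+ j * w | j <- iota 0 m, w <- t].
  move=> yt; apply/allpairsP; exists (i %% m, y); split=> //=.
    by rewrite mem_iota ltn_mod.
  by rewrite {1}(divn_eq i m) expgnDr mulnC expgnA xm expg1n mul1g.
exists [seq x ^+ j * w | j <- iota 0 m, w <- t]; split.
- by have := memt 0 1 t1; rewrite expg0 mulg1.
- move=> _ _ /allpairsP[[i y] /= [_ yt ->]] /allpairsP[[j w] /= [_ wt ->]].
  have -> : x ^+ i * y * (x ^+ j * w) = x ^+ (i + j) * (y * w).
    rewrite expgnDr -!mulgA; congr (_ * _); rewrite !mulgA; congr (_ * _).
    by apply/commuteX/commute_sym/cx.
  by rewrite memt ?tM.
- move=> y; rewrite inE => /orP[/eqP->|/st yt].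
    by have := memt 1%N 1 t1; rewrite expg1 mulg1.
  by have := memt 0 y yt; rewrite expg0 mul1g.
- move=> _ /allpairsP[[i y] /= [_ yt ->]].
  rewrite expgMn; last by apply/commute_sym/commuteX/commute_sym/cx.
  by rewrite (tm y yt) mulg1 -expgnA mulnC expgnA xm expg1n.
move=> c cs' _ /allpairsP[[i y] /= [_ yt ->]]; apply: commuteM.
  by apply/commuteX/cs'; rewrite mem_head.
by apply: tc yt => w ws; apply: cs'; rewrite inE ws orbT.
Qed.

End Generated.

HB.instance Definition _ (G : groupType) :=
  Multiplicative_isUMagmaMorphism.Build G (chi G) (@chi_g G)
    (proj2 (chi_piP [:: (false, 1)] [::]) (chi_cong_one _ _)).
HB.instance Definition _ (G : groupType) :=
  Multiplicative_isUMagmaMorphism.Build G (chi G) (@chi_phi G)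
    (proj2 (chi_piP [:: (true, 1)] [::]) (chi_cong_one _ _)).

Lemma chi_inE (G : groupType) b g :
  chi_in b g = (if b then @chi_phi G g else chi_g g).
Proof. by case: b. Qed.

Definition chi_word_of (G : groupType) (x : chi G) : chi_word G :=
  generic_quotient.repr (x : {eq_quot chi_equiv G}%qT).

Lemma chi_word_ofK (G : groupType) (x : chi G) : chi_pi (chi_word_of x) = x.
Proof. exact: chi_reprK. Qed.

Lemma chi_ind (G : groupType) (P : chi G -> Prop) :
  P 1 -> (forall b g x, P x -> P (chi_in b g * x)) -> forall x, P x.
Proof.
move=> P1 PM x; rewrite -[x]chi_word_ofK.
elim: (chi_word_of x) => [//|[b g] w IHw].
by rewrite -cat1s chi_pi_cat; apply: PM.
Qed.

(** * The kernel of the map from chi(G) to chi(G/<z>) for a central z *)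

Section CentralQuotient.
Variables (G : finGroupType) (z : G).
Hypothesis cz : forall g, commute z g.

Let N := <[z]>%G.
Let u h := [~ chi_g z, chi_phi h] : chi G.
Let s : seq (chi G) := [:: chi_g z, chi_phi z & [seq u h | h <- enum G]].
Let K : set (chi G) := Defs.generated (fun x => x \in s).

Let K1 : K 1. Proof. by have [] := generated_subgroup (fun x => x \in s). Qed.
Let KM x y : K x -> K y -> K (x * y).
Proof.
by have [_ KM _] := generated_subgroup (fun x => x \in s); apply: KM.
Qed.
Let KV x : K x -> K x^-1.
Proof.
by have [_ _ KV] := generated_subgroup (fun x => x \in s); apply: KV.
Qed.
Let Kg : K (chi_g z). Proof. by apply: mem_generated; rewrite /= mem_head. Qed.
Let Kphi : K (chi_phi z).
Proof. by apply: mem_generated; rewrite /= !inE eqxx orbT. Qed.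
Let Ku h : K (u h).
Proof.
by apply: mem_generated; rewrite /= !inE map_f ?orbT // mem_enum.
Qed.

Let ab_comm := @chi_commute G.

(** Checked on one letter and one generator of [K] at a time: [chi_g z ^ chi_phi g = chi_g z * u g],
    the mirror case follows by [weak_comm_swap], and a conjugate of [u h] by a letter is
    [(u k)^-1 * u (h * k)]. *)
Let KJ y : forall x, K x -> K (x ^ y).
Proof.
elim/chi_ind: y => [x|b g y IHy x Kx]; first by rewrite conjg1.
rewrite conjgM; apply: IHy; apply: (generated_min (H := fun x => K (x ^ _))) Kx.
  split=> [|x1 x2 K1x K2x|x1 K1x]; first by rewrite conj1g.
    by rewrite conjMg; apply: KM.
  by rewrite conjVg; apply: KV.
move=> w; rewrite /s !inE => /or3P[/eqP->|/eqP->|/mapP[h _ ->]].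
- case: b; last by rewrite chi_inE -gmulfJ /conjg cz mulKg.
  by rewrite chi_inE -[_ ^ _](mulVKg (chi_g z)) -commgEl; apply: KM Kg (Ku _).
- case: b; first by rewrite chi_inE -gmulfJ /conjg cz mulKg.
  rewrite chi_inE -[_ ^ _](mulVKg (chi_phi z)) -commgEl -weak_comm_swap //.
  exact: KM Kphi (Ku _).
case: b; rewrite chi_inE -?weak_comm_conj // weak_comm_central_conj //;
  exact: KM (KV (Ku _)) (Ku _).
Qed.

Let K_finite :
  exists t : seq (chi G), forall x, K x -> x \in t /\ x ^+ #[z] = 1.
Proof.
have zm := expg_order z.
apply: abelian_generated_finite => // [x y|x]; last first.
  rewrite !inE => /or3P[/eqP->|/eqP->|/mapP[h _ ->]].
  - by rewrite -gmulfXn zm gmulf1.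
  - by rewrite -gmulfXn zm gmulf1.
  - exact: weak_comm_central_exp.
have cu h := weak_comm_central_fix ab_comm cz h.
rewrite !inE => /or3P[/eqP->|/eqP->|/mapP[h _ ->]];
  move=> /or3P[/eqP->|/eqP->|/mapP[k _ ->]] //.
- exact/commute_sym/(cu _).1.
- by apply/commute_sym; apply: ab_comm.
- exact/commute_sym/(cu _).2.
- exact: (cu _).1.
- exact: (cu _).2.
- exact: weak_comm_central_comm.
Qed.

Let eqK (x y : chi G) := K (x^-1 * y).

Let eqK_refl x : eqK x x. Proof. by rewrite /eqK mulVg. Qed.
Let eqK_sym x y : eqK x y -> eqK y x.
Proof. by move=> /KV; rewrite invMg invgK. Qed.
Let eqK_trans y x w : eqK x y -> eqK y w -> eqK x w.
Proof. by move=> xy yw; have := KM xy yw; rewrite mulgA mulgK. Qed.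
Let eqKM x x' y y' : eqK x x' -> eqK y y' -> eqK (x * y) (x' * y').
Proof.
move=> xx' yy'; have := KM (KJ y xx') yy'.
by rewrite /eqK /conjg invMg !mulgA mulgK.
Qed.

(** Representatives are chosen letter by letter, so the congruence is respected only modulo [K]. *)
Let lift_word (w : chi_word (coset_of N)) : chi G :=
  chi_pi [seq (c.1, repr c.2) | c : bool * coset_of N <- w].

Let nN x : x \in 'N(N).
Proof.
apply: subsetP (cent_sub _) _ _; rewrite cent_cycle.
exact/cent1P/commute_sym/cz.
Qed.

Let eqK_in b g h : coset N g = coset N h -> eqK (chi_in b g) (chi_in b h).
Proof.
move=> /esym/(rcoset_kercosetP (nN h) (nN g)); rewrite mem_rcoset.
case/cycleP=> i E; have {E}-> : h = g * z ^+ i.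
  by rewrite (commuteX i (commute_sym (cz g))) -E mulgKV.
have Kz : K (chi_in b z) by case: b; rewrite chi_inE.
have zi : K (chi_in b z ^+ i).
  by elim: i => [|i IHi]; rewrite ?expg0 // expgS; apply: KM.
suff -> : chi_in b (g * z ^+ i) = chi_in b g * chi_in b z ^+ i.
  by rewrite /eqK mulKg.
by case: b {Kz zi}; rewrite !chi_inE gmulfM gmulfXn.
Qed.

(** As [K] is normal, only the defining relations need lifting. [repr x * repr y] and [repr (x * y)]
    differ by a power of [z]; both copies use the same representative, so the commutation relation
    lifts exactly. *)
Let lift_word_cong v w : chi_cong v w -> eqK (lift_word v) (lift_word w).
Proof.
elim=> {v w} [v|v w _|v v' w _ IHv _|v v' w w' _ IHv _ IHw|b|b x y|g].
- exact: eqK_refl.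
- exact: eqK_sym.
- exact: eqK_trans.
- by rewrite /lift_word !map_cat !chi_pi_cat; apply: eqKM.
- rewrite /lift_word /= repr_coset1.
  by case: b; rewrite -/(chi_in _ _) chi_inE gmulf1.
- have -> : lift_word [:: (b, x); (b, y)] = chi_in b (repr x * repr y).
    by case: b; rewrite [RHS]chi_inE gmulfM -chi_pi_cat.
  apply: eqK_in; apply: (etrans _ (esym (coset_reprK (x * y)))).
  by rewrite morphM ?nN //= !coset_reprK.
rewrite /lift_word /=; have /chi_piP-> := chi_cong_comm (repr g).
exact: eqK_refl.
Qed.

Let chi_pi_lift w :
  eqK (chi_pi w) (lift_word [seq (c.1, coset N c.2) | c <- w]).
Proof.
elim: w => [|[b g] w IHw]; first exact: eqK_refl.
have consE c (v : chi_word G) : chi_pi (c :: v) = chi_pi [:: c] * chi_pi v.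
  exact: (chi_pi_cat [:: c]).
rewrite /lift_word /= consE [X in eqK _ X]consE; apply: eqKM => //.
by apply: eqK_in; rewrite coset_reprK.
Qed.

(** The kernel of the map induced by [coset N] lies in [K]. *)
Let eqK_of_chi_eq w1 w2 :
  chi_pi [seq (c.1, coset N c.2) | c <- w1] =
  chi_pi [seq (c.1, coset N c.2) | c <- w2] -> eqK (chi_pi w1) (chi_pi w2).
Proof.
move/chi_piP/lift_word_cong => E.
apply: eqK_trans (chi_pi_lift w1) _; apply: eqK_trans E _.
exact: eqK_sym (chi_pi_lift w2).
Qed.

Lemma chi_finite_central_quotient :
  (exists t : seq (chi (coset_of N)), forall x : chi (coset_of N), x \in t) ->
  exists t : seq (chi G), forall x : chi G, x \in t.
Proof.
move=> [t tP]; have [k kP] := K_finite.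
exists [seq lift_word (chi_word_of y) * w | y <- t, w <- k] => x.
rewrite -[x]chi_word_ofK; set w := chi_word_of x.
pose y := chi_pi [seq (c.1, coset N c.2) | c <- w].
have : eqK (lift_word (chi_word_of y)) (chi_pi w).
  apply: eqK_trans _ (eqK_sym (chi_pi_lift w)).
  by apply: lift_word_cong; apply/chi_piP; rewrite chi_word_ofK.
move=> /kP[wk _]; apply/allpairsP.
by exists (y, (lift_word (chi_word_of y))^-1 * chi_pi w); rewrite /= mulVKg.
Qed.

Lemma chi_exp_central_quotient (p e : nat) :
  z ^+ (p ^ e) = 1 ->
  (forall x : chi (coset_of N), exists i, x ^+ (p ^ i) = 1) ->
  forall x : chi G, exists i, x ^+ (p ^ i) = 1.
Proof.
move=> ze HN x; rewrite -[x]chi_word_ofK; set w := chi_word_of x.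
have [i E] := HN (chi_pi [seq (c.1, coset N c.2) | c <- w]).
(* Powers are written as words, so that [eqK_of_chi_eq] can compare [w] repeated [p ^ i] times with
   the empty word. *)
have powE (H : groupType) (v : chi_word H) n :
    chi_pi v ^+ n = chi_pi (flatten (nseq n v)).
  by elim: n => [//|n IHn]; rewrite expgS IHn -chi_pi_cat.
have [k kP] := K_finite.
have /kP[_ xm] : K (chi_pi w ^+ (p ^ i)).
  rewrite -[X in K X]invgK; apply: KV; rewrite -[_^-1]mulg1 powE.
  by apply: (@eqK_of_chi_eq _ [::]); rewrite map_flatten map_nseq -powE E.
have /dvdnP[d dE] : #[z] %| p ^ e by rewrite order_dvdn ze.
by exists (i + e)%N; rewrite expnD expgM dE mulnC expgM xm expg1n.
Qed.

End CentralQuotient.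

(** * chi(G) is a finite p-group *)

Lemma pgroup_exp (F : finGroupType) p :
  prime p -> (forall x : F, exists i, x ^+ (p ^ i) = 1) -> p.-group [set: F].
Proof.
move=> p_pr HF; apply/pgroupP => q q_pr /(Cauchy q_pr)[x _ xq].
have [i /eqP] := HF x; rewrite -order_dvdn xq Euclid_dvdX // => /andP[qp _].
by rewrite inE /= -dvdn_prime2.
Qed.

Section Listed.
Variables (T : groupType) (t : seq T).
Hypothesis tP : forall x, x \in t.

(** The proof that [t] exhausts [T] is a parameter of the type because the group operations are
    defined through it. *)
Definition listed of (forall x, x \in t) : predArgType := seq_sub t.
Local Notation L := (listed tP).
HB.instance Definition _ := Finite.on L.

Let mk (x : T) : L := SeqSub (tP x).
Let mkK (x : L) : mk (ssval x) = x. Proof. exact/val_inj. Qed.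

Let mul (x y : L) := mk (ssval x * ssval y).
Let inv (x : L) := mk (ssval x)^-1.

Fact listed_mulA : associative mul.
Proof. by move=> x y w; apply: val_inj; rewrite /= mulgA. Qed.
Fact listed_mul1 : left_id (mk 1) mul.
Proof. by move=> x; apply: val_inj; rewrite /= mul1g. Qed.
Fact listed_mulV : left_inverse (mk 1) inv mul.
Proof. by move=> x; apply: val_inj; rewrite /= mulVg. Qed.

HB.instance Definition _ :=
  Finite_isGroup.Build L listed_mulA listed_mul1 listed_mulV.

Definition listed_val (x : L) : T := ssval x.

Fact listed_valM : {morph listed_val : x y / x * y}. Proof. by []. Qed.

HB.instance Definition _ := isMultiplicative.Build L T listed_val listed_valM.

Lemma listed_val_bij : bijective listed_val.
Proof. by exists mk. Qed.

End Listed.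

Lemma listed_finite_pgroup (T : groupType) p :
    prime p -> (exists t : seq T, forall x, x \in t) ->
    (forall x : T, exists i, x ^+ (p ^ i) = 1) ->
  finite_pgroup T p.
Proof.
move=> p_pr [t tP] HT; exists (listed tP : finGroupType), (@listed_val T t tP).
split; first exact: listed_val_bij.
apply: pgroup_exp => // x; have [i E] := HT (listed_val x); exists i.
apply: val_inj; rewrite /= -[RHS]/1 -E.
by elim: (p ^ i)%N => [//|n IHn]; rewrite !expgS /= IHn.
Qed.

(** The bound [n] drives the induction, since [G] is replaced by the type of cosets of a central
    [<[z]>]. The exponent condition passes to cosets through representatives. *)
Lemma chi_finite_exp p n (G : finGroupType) :
    prime p -> #|G| <= n -> (forall x : G, exists i, x ^+ (p ^ i) = 1) ->
  (exists t : seq (chi G), forall x, x \in t) /\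
  (forall x : chi G, exists i, x ^+ (p ^ i) = 1).
Proof.
move=> p_pr; elim: n G => [|n IHn] G leG HG.
  by case: (fintype0 (1 : G)); apply/eqP; rewrite -leqn0.
have pG := pgroup_exp p_pr HG.
(* A nilpotent group with trivial centre is trivial, and then so is [chi G]. *)
have [| ntZ] := boolP ('Z([set: G]) == 1 :> {set G}).
  rewrite center_nil_eq1 ?(pgroup_nil pG) // => /eqP G1.
  have chi1 : forall x : chi G, x = 1.
    elim/chi_ind => [//|b g x ->]; rewrite mulg1.
    have -> : g = 1 by apply/set1gP; rewrite -G1 inE.
    by case: b; rewrite chi_inE gmulf1.
  split; first by exists [:: 1] => x; rewrite inE [x]chi1.
  by move=> x; exists 0; rewrite [x]chi1 expg1n.
have [z Zz ntz] : exists2 z, z \in 'Z([set: G]) & z != 1.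
  by apply/trivgPn.
have cz g : commute z g.
  by case/centerP: Zz => _ cz; apply: cz; rewrite inE.
have [e ze] := HG z.
have [||fin ex] := IHn (coset_of <[z]>).
- have ltq : #|[set: G] / <[z]>| < #|[set: G]|.
    by rewrite ltn_quotient ?subsetT // cycle_eq1.
  rewrite -ltnS; apply: leq_trans leG; rewrite -[X in _ < X]cardsT.
  apply: leq_ltn_trans ltq; rewrite -cardsT subset_leq_card //.
  by apply/subsetP => x _; rewrite -(coset_reprK x) mem_quotient ?inE.
- move=> x; have [i E] := HG (repr x); exists i.
  rewrite -[x]coset_reprK -morphX ?E ?morph1 //.
  apply: subsetP (cent_sub _) _ _; rewrite cent_cycle.
  exact/cent1P/commute_sym/cz.
split; first exact: chi_finite_central_quotient cz fin.
exact: chi_exp_central_quotient cz _ _ ze ex.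
Qed.

(** * Subgroups of p-th powers and reduction to central quotients *)

Definition pow_group (F : finGroupType) p (A : {set F}) : {group F} :=
  <<[set x ^+ p | x in A]>>%G.

Section PowGroup.
Variables (F : finGroupType) (p : nat).
Implicit Types (A : {set F}) (N : {group F}).

Lemma mem_pow_group A x : x \in A -> x ^+ p \in pow_group p A.
Proof. by move=> Ax; apply/mem_gen/imset_f. Qed.

Lemma pow_groupS (A B : {set F}) :
  A \subset B -> pow_group p A \subset pow_group p B.
Proof. by move=> sAB; apply/genS/imsetS. Qed.

Lemma norm_pow_group A : 'N(A) \subset 'N(pow_group p A).
Proof.
apply/norms_gen/subsetP => g nAg; rewrite inE.
apply/subsetP => _ /imsetP[_ /imsetP[x Ax ->] ->]; rewrite conjXg.
by apply: (imset_f (natexp^~ p)); rewrite memJ_norm.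
Qed.

(** Taking for [K] the product of N^p and [N,F,F] places [N,F] inside [N,F,F] modulo N^p. In a
    nilpotent group this forces [N,F] to be trivial modulo N^p. *)
Lemma comm_sub_pow N :
    p.-group [set: F] -> N <| [set: F] ->
    (forall K : {group F}, K <| [set: F] -> pow_group p N \subset K ->
       [~: N, [set: F], [set: F]] \subset K -> [~: N, [set: F]] \subset K) ->
  [~: N, [set: F]] \subset pow_group p N.
Proof.
move=> pF /andP[_ nNF] HK; set M := pow_group p N.
have nMF : [set: F] \subset 'N(M) := subset_trans nNF (norm_pow_group _).
have nRF : [set: F] \subset 'N([~: N, [set: F], [set: F]]).
  exact: commg_normr.
have nX (X : {set F}) : X \subset 'N(M).
  by apply: subset_trans nMF; apply: subsetT.
have /HK : (M <*> [~: N, [set: F], [set: F]])%G <| [set: F].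
  by rewrite /normal subsetT normsY.
rewrite joing_subl joing_subr => /(_ isT isT) sNR.
rewrite -quotient_sub1 ?nX //; apply/trivgP.
have nilF : nilpotent ([set: F] / M) by rewrite quotient_nil ?(pgroup_nil pF).
apply/eqP; apply: contraTT sNR => ntR.
have: [~: [~: N, [set: F]] / M, [set: F] / M] \proper [~: N, [set: F]] / M.
  rewrite (nil_comm_properl nilF) ?quotientS ?subsetT //.
  by rewrite subsetI subxx quotient_norms ?commg_normr.
rewrite /= -quotientR ?nX // properE => /andP[_]; apply: contra => sNR.
apply: subset_trans (quotientS M sNR) _.
by rewrite quotientYidl ?nX.
Qed.

End PowGroup.

(* In class at most 3, [x^p, y] = [x,y]^p [x,y,x]^(p choose 2). *)
Lemma commute_expX (F : finGroupType) p (x y : F) :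
    prime p -> odd p -> [~ x, y] ^+ p = 1 -> [~ x, y, x] ^+ p = 1 ->
    (forall r, commute [~ x, y, x] r) ->
  commute (x ^+ p) y.
Proof.
move=> p_pr p_odd cp fp fZ; apply/commgP; rewrite -conjg_fix conjXg.
rewrite conjg_mulR expMg_Rmul; try by apply/commute_sym/fZ.
have /dvdnP[k ->] : p %| 'C(p, 2).
  by rewrite prime_dvd_bin // odd_prime_gt2.
by rewrite cp mulg1 mulnC expgM fp expg1n mulg1.
Qed.

Lemma image_gen (G Q : finGroupType) (a : UMagmaMorphism.type G Q)
    (A : {set G}) (X : {group Q}) :
  (forall x, x \in A -> a x \in X) -> forall w, w \in <<A>> -> a w \in X.
Proof.
move=> aX w; suff /subsetP sub : <<A>> \subset [set g | a g \in X].
  by move/sub; rewrite inE.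
have gX : group_set [set g | a g \in X].
  apply/group_setP; rewrite inE gmulf1 group1; split=> // x y.
  by rewrite !inE gmulfM; apply: groupM.
rewrite -[[set g | _]]/(gval (Group gX)) gen_subG.
by apply/subsetP => x Ax; rewrite inE aX.
Qed.

Lemma image_pow_group (G Q : finGroupType) (a : UMagmaMorphism.type G Q) p
    (A : {set G}) (X : {group Q}) :
  (forall x, x \in A -> a x ^+ p \in X) ->
  forall w, w \in pow_group p A -> a w \in X.
Proof.
move=> aX; apply: image_gen => _ /imsetP[x Ax ->].
by rewrite gmulfXn aX.
Qed.

Lemma comm_gen_sub (Q : finGroupType) (S : {set Q}) (Z : {group Q}) :
  S \subset 'N(Z) -> [~: S, S] \subset Z -> [~: <<S>>, <<S>>] \subset Z.
Proof.
move=> nZS sSZ; rewrite -quotient_cents2 ?gen_subG // quotient_gen //.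
by rewrite -/(abelian _) abelian_gen /abelian quotient_cents2.
Qed.

Lemma image_group_set (G Q : finGroupType) (a : UMagmaMorphism.type G Q) :
  group_set (a @: [set: G]).
Proof.
apply/group_setP; split; first by apply/imsetP; exists 1; rewrite ?inE ?gmulf1.
by move=> _ _ /imsetP[x _ ->] /imsetP[y _ ->]; rewrite -gmulfM imset_f.
Qed.
Definition image_group (G Q : finGroupType) (a : UMagmaMorphism.type G Q) :=
  Group (image_group_set a).

(** * Centrality of D and of derived subgroups when they have exponent p *)

Section PowerfulWeakPair.
Variables (G : finGroupType) (p : nat).
Hypotheses (p_pr : prime p) (p_odd : odd p).
Hypothesis pwG : [~: [set: G], [set: G]] \subset pow_group p [set: G].

(** Here p-th powers are central by [commute_expX], and G' lies in G^p. This is the reduced case of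
    the fact that G' is powerfully embedded in G. *)
Lemma powerful_der_exp :
    (forall x : G, x \in [~: [set: G], [set: G]] -> x ^+ p = 1) ->
    [~: [set: G], [set: G], [set: G], [set: G]] = 1 ->
  [~: [set: G], [set: G], [set: G]] = 1.
Proof.
move=> exp1 /commG1P c3; apply/commG1P; apply: subset_trans pwG _.
rewrite gen_subG; apply/subsetP => _ /imsetP[x _ ->].
apply/centP => y _; apply: commute_expX => // [||r].
- by apply: exp1; rewrite mem_commg ?inE.
- apply: exp1; apply: (subsetP (commSg _ (subsetT _))).
  by rewrite !mem_commg ?inE.
by apply: (centP (subsetP c3 _ _)); rewrite ?mem_commg ?inE.
Qed.

Section Pair.
Variables (Q : finGroupType) (a b : UMagmaMorphism.type G Q).
Hypothesis ab_comm : forall g, commute (a g) (b g).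
Hypothesis ab_gen : <<image_group a :|: image_group b>> = [set: Q].

Let D := [~: image_group a, image_group b].

Let a_in g : a g \in image_group a. Proof. exact: imset_f. Qed.
Let b_in g : b g \in image_group b. Proof. exact: imset_f. Qed.

Let cent_gen (x : Q) :
  (forall g, commute x (a g)) -> (forall g, commute x (b g)) ->
  forall y, commute x y.
Proof.
move=> xa xb y; apply/commute_sym/cent1P; move: (in_setT y).
move: y; apply/subsetP.
rewrite -ab_gen gen_subG subUset; apply/andP; split.
  by apply/subsetP => _ /imsetP[g _ ->]; apply/cent1P/commute_sym.
by apply/subsetP => _ /imsetP[g _ ->]; apply/cent1P/commute_sym.
Qed.

Lemma weak_comm_group_normal : D <| [set: Q].
Proof.
rewrite /normal subsetT -ab_gen.
exact: commg_norm.
Qed.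

Let memD g h : [~ a g, b h] \in D. Proof. exact: mem_commg. Qed.

Lemma weak_comm_group_central :
  (forall x, x \in D -> x ^+ p = 1) -> [~: D, [set: Q], [set: Q]] = 1 ->
  [~: D, [set: Q]] = 1.
Proof.
move=> exp1 /commG1P c3.
have cenR d q r : d \in D -> commute [~ d, q] r.
  by move=> Dd; apply: (centP (subsetP c3 _ _)); rewrite ?mem_commg ?inE.
have memR d q : d \in D -> [~ d, q] \in D.
  move=> Dd; apply: (subsetP (_ : [~: D, [set: Q]] \subset D)).
    by rewrite commg_subl (normal_norm weak_comm_group_normal).
  by rewrite mem_commg ?inE.
have der_pow x y : [~ x, y] \in pow_group p [set: G].
  by apply: (subsetP pwG); rewrite mem_commg ?inE.
(* [[~ d, a x]] is central of exponent p, so [[~ d, a x ^+ p] = [~ d, a x] ^+ p = 1]. *)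
have pow_cent w d : w \in pow_group p [set: G] -> d \in D -> commute (a w) d.
  move=> pw Dd; apply: (centP (A := D)) => //; move: w pw.
  apply: image_pow_group => x _; apply/centP => e De.
  apply/commute_sym/commgP; rewrite commgX; last exact/commute_sym/cenR.
  by rewrite exp1 // memR.
(* [[~ a x, b y]] acts as [a [~ x, y]], and [[~ x, y]] lies in G^p. *)
have cc g h x y : commute [~ a g, b h] [~ a x, b y].
  apply/commgP; rewrite -conjg_fix weak_comm_conj_comm // conjg_fix.
  exact/commgP/commute_sym/(pow_cent _ _ _ (memD _ _)).
have pow_b w h : w \in pow_group p [set: G] -> commute (a w) (b h).
  move=> pw; apply: (centP (A := image_group b)) => //; move: w pw.
  apply: image_pow_group => x _; apply/centP => _ /imsetP[k _ ->].
  apply: commute_expX => // [||r]; first exact/exp1/memD.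
    exact/exp1/memR/memD.
  exact: cenR (memD _ _).
pose f g k h := [~ a g, b h, a k].
have fZ g k h r : commute (f g k h) r by apply: cenR (memD _ _).
have fM g k h : [~ a (g * k), b h] = [~ a g, b h] * f g k h * [~ a k, b h].
  by rewrite gmulfM commMgR.
(* [g * k] and [k * g] differ by [[~ g, k]], whose image under [a] commutes with [b h] and with D.
   Expanding both sides by [fM] then leaves the two values of [f]. *)
have fS g k h : f g k h = f k g h.
  have E : [~ a (g * k), b h] = [~ a (k * g), b h].
    rewrite commgC gmulfM commMgJ.
    have /commgP/eqP -> := pow_b _ h (der_pow g k).
    by rewrite mulg1 /conjg -(pow_cent _ _ (der_pow g k) (memD _ h)) mulKg.
  move: E (cc g h k h) (fZ g k h) (fZ k g h); rewrite !fM.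
  move: (f g k h) (f k g h) [~ a g, b h] [~ a k, b h] => v w x y E xy vZ wZ.
  by move: E; rewrite -(vZ x) -(wZ y) -!mulgA xy => /mulIg.
(* From [[~ a g, b h] = [~ b g, a h] = [~ a h, b g]^-1]. *)
have fA g k h : f g k h = (f h k g)^-1.
  rewrite /f weak_comm_swap // -invgR commVg //.
  exact/commute_sym/fZ.
have f1 g k h : f g k h = 1.
  (* Exchanging the outer arguments and then the first two, three times over, returns to the start
     after three inversions. *)
  have fV : f g k h = (f g k h)^-1.
    rewrite [LHS]fA (fS h) (fA k h g) invgK (fS g h) (fA h g k).
    by rewrite (fS k g).
  have f2 : f g k h ^+ 2 = 1 by rewrite expgS expg1 {2}fV mulgV.
  have := exp1 (f g k h) (memR _ _ (memD _ _)).
  by rewrite -(odd_double_half p) p_odd expgS -mul2n expgM f2 expg1n mulg1.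
apply/commG1P; rewrite gen_subG.
apply/subsetP => _ /imset2P[_ _ /imsetP[g _ ->] /imsetP[h _ ->] ->].
(* Commuting with every [a k] suffices, since [b k] acts on the commutator in the same way. *)
have ca k : commute [~ a g, b h] (a k) by apply/commgP; rewrite -/(f g k h) f1.
apply/centP => y _; apply: cent_gen => // k.
by apply/commgP; rewrite -conjg_fix -weak_comm_conj // conjg_fix; apply/commgP.
Qed.

Lemma derived_central :
    [~: [~: [set: G], [set: G]], [set: G]] \subset
      pow_group p [~: [set: G], [set: G]] ->
    (forall x, x \in [~: [set: Q], [set: Q]] -> x ^+ p = 1) ->
    [~: D, [set: Q]] = 1 ->
  [~: [set: Q], [set: Q], [set: Q]] = 1.
Proof.
move=> pe_der exp1 /commG1P/subsetP cD.
have der_exp (c : UMagmaMorphism.type G Q) x :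
    x \in [~: [set: G], [set: G]] -> c x ^+ p = 1.
  move=> derx; apply: exp1; move: x derx; apply: image_gen.
  by move=> _ /imset2P[x y _ _ ->]; rewrite gmulfR mem_commg ?inE.
(* [[~ w, h]] lies in the subgroup generated by p-th powers of elements of G', which [c] sends to
   1. *)
have der_same (c : UMagmaMorphism.type G Q) w h :
    w \in [~: [set: G], [set: G]] -> commute (c w) (c h).
  move=> derw; apply/commgP; rewrite -gmulfR; apply/eqP/set1gP.
  apply: (image_pow_group (X := 1%G) (p := p) (A := [~: [set: G], [set: G]])).
    by move=> x derx; apply/set1gP/der_exp.
  by apply: (subsetP pe_der); rewrite mem_commg ?inE.
(* Serves for [(a, b)] and [(b, a)]. As [w] lies in G^p, it is enough that [[~ c x ^+ p, d h] =
   [~ c x, d h] ^+ p = 1], the commutator being central. *)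
have der_other (c d : UMagmaMorphism.type G Q) :
    (forall g h, [~ c g, d h] \in 'C([set: Q])) ->
  forall w h, w \in [~: [set: G], [set: G]] -> commute (c w) (d h).
  move=> cd w h derw; apply/cent1P; have := subsetP pwG _ derw.
  move: w {derw}; apply: image_pow_group => x _; apply/cent1P/commgP.
  rewrite commXg; last exact/commute_sym/(centP (cd _ _)).
  by rewrite exp1 // mem_commg ?inE.
have Dba g h : [~ b g, a h] \in 'C([set: Q]) by rewrite -weak_comm_swap ?cD.
have Dab g h : [~ a g, b h] \in 'C([set: Q]) by rewrite cD.
set Z := 'C([set: Q]) in cD Dab Dba der_other *.
have nZ (X : {set Q}) : X \subset 'N(Z).
  exact/norms_cent/(subset_trans (subsetT X))/(normG [set: Q]%G).
(* Commutators of generators are central: those across the copies lie in D up to inversion, those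
   within a copy are images of elements of G'. *)
have sSZ : [~: image_group a :|: image_group b,
               image_group a :|: image_group b] \subset Z.
  rewrite gen_subG; apply/subsetP => _ /imset2P[v w Sv Sw ->].
  have derm x y : [~ x, y] \in [~: [set: G], [set: G]].
    by rewrite mem_commg ?inE.
  case/setUP: Sv => /imsetP[x _ ->]; case/setUP: Sw => /imsetP[y _ ->] //;
    rewrite -gmulfR; apply/centP => r _; apply: cent_gen => k.
  - exact: der_same.
  - exact: der_other.
  - exact: der_other.
  - exact: der_same.
by apply/commG1P; rewrite -{1 2}ab_gen; apply: comm_gen_sub; rewrite ?nZ.
Qed.

End Pair.
End PowerfulWeakPair.

(** * Passage to quotients by normal subgroups *)

Lemma quotient_setT (F : finGroupType) (K : {group F}) :
  [set: F] / K = [set: coset_of K].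
Proof.
apply/eqP; rewrite eqEsubset subsetT; apply/subsetP => x _.
by rewrite -(coset_reprK x) mem_quotient ?inE.
Qed.

Section QuotientPair.
Variables (G F : finGroupType) (K : {group F}).
Hypothesis nK : K <| [set: F].

Let inN x : x \in 'N(K).
Proof. by apply: (subsetP (normal_norm nK)); rewrite inE. Qed.

Let subN (X : {set F}) : X \subset 'N(K).
Proof. exact/subset_trans/(normal_norm nK)/subsetT. Qed.

Lemma quotient_pow_exp p (N : {set F}) :
  pow_group p N \subset K -> forall x, x \in N / K -> x ^+ p = 1.
Proof.
move=> sNK x /morphimP[y _ Ny ->]; rewrite -morphX //; apply: coset_id.
by rewrite (subsetP sNK) // mem_pow_group.
Qed.

Lemma quotient_comm_eq1 (X Y : {set F}) :
  [~: X / K, Y / K] = 1 <-> [~: X, Y] \subset K.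
Proof.
rewrite -quotient_cents2 //; split; first by move/commG1P.
by move=> XY; apply/commG1P.
Qed.

(** Normality is an argument so that morphism instances can be attached: [coset K] is a morphism on
    the normaliser of [K]. *)
Definition coset_comp of K <| [set: F] :=
  fun (c : UMagmaMorphism.type G F) (g : G) => coset K (c g).

Variable c : UMagmaMorphism.type G F.

Fact coset_compM : {morph coset_comp nK c : x y / x * y}.
Proof. by move=> x y; rewrite /coset_comp gmulfM morphM. Qed.

Fact coset_comp1 : coset_comp nK c 1 = 1.
Proof. by rewrite /coset_comp gmulf1 morph1. Qed.

HB.instance Definition _ :=
  isMultiplicative.Build G (coset_of K) (coset_comp nK c) coset_compM.
HB.instance Definition _ :=
  Multiplicative_isUMagmaMorphism.Build G (coset_of K) (coset_comp nK c)
    coset_comp1.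

Lemma image_coset_comp :
  image_group (coset_comp nK c) = image_group c / K :> {set _}.
Proof. by rewrite /quotient morphimEsub ?subN //= -imset_comp. Qed.

End QuotientPair.

(** * Powerful embedding in finite groups *)

Section Embedded.
Variables (G F : finGroupType) (p : nat) (a b : UMagmaMorphism.type G F).
Hypotheses (p_pr : prime p) (p_odd : odd p).
Hypotheses (pG : p.-group [set: G]) (pF : p.-group [set: F]).
Hypothesis pwG : [~: [set: G], [set: G]] \subset pow_group p [set: G].
Hypothesis ab_comm : forall g, commute (a g) (b g).
Hypothesis ab_gen : <<image_group a :|: image_group b>> = [set: F].

Let D := [~: image_group a, image_group b]%G.

Section Coset.
Variables (K : {group F}) (nK : K <| [set: F]).

Lemma coset_comp_commute g : commute (coset_comp nK a g) (coset_comp nK b g).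
Proof.
have inN x : x \in 'N(K) by apply: (subsetP (normal_norm nK)); rewrite inE.
by rewrite /commute /coset_comp -!morphM // ab_comm.
Qed.

Lemma coset_comp_gen :
  <<image_group (coset_comp nK a) :|: image_group (coset_comp nK b)>>
    = [set: coset_of K].
Proof.
rewrite !image_coset_comp -quotientU -quotient_gen ?ab_gen ?quotient_setT //.
exact/subset_trans/(normal_norm nK)/subsetT.
Qed.

End Coset.

Lemma weak_comm_group_embedded : [~: D, [set: F]] \subset pow_group p D.
Proof.
apply: comm_sub_pow => // [|K nK sDK]; first exact: weak_comm_group_normal.
have subN (X : {set F}) : X \subset 'N(K).
  exact/subset_trans/(normal_norm nK)/subsetT.
have := weak_comm_group_central p_pr p_odd pwG (coset_comp_commute nK)
  (coset_comp_gen nK).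
rewrite !image_coset_comp -quotientR // -quotient_setT.
move=> /(_ (quotient_pow_exp nK sDK)) cD sRK.
apply/(quotient_comm_eq1 nK)/cD; rewrite -quotientR //.
exact/quotient_comm_eq1.
Qed.

Lemma powerful_derived_embedded :
  [~: [~: [set: G], [set: G]], [set: G]]
    \subset pow_group p [~: [set: G], [set: G]].
Proof.
apply: comm_sub_pow => // [|K nK sDK]; first exact: (der_normal 1).
have subN (X : {set G}) : X \subset 'N(K).
  exact/subset_trans/(normal_norm nK)/subsetT.
move=> sRK; apply/(quotient_comm_eq1 nK).
rewrite quotientR // quotient_setT; apply: powerful_der_exp p_pr p_odd _ _ _.
(* The quotient of [G] by [K] still has its derived subgroup inside its subgroup of p-th powers. *)
- rewrite -quotient_setT -quotientR //; apply: subset_trans (quotientS K pwG) _.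
  rewrite quotient_gen // genS //; apply/subsetP => _ /morphimP[y Ny Sy ->].
  case/imsetP: Sy => x _ ->; rewrite morphX ?(subsetP (subN setT)) ?inE //.
  by apply: (imset_f (natexp^~ p)); rewrite mem_quotient ?inE.
- by rewrite -quotient_setT -quotientR //; exact: (quotient_pow_exp nK sDK).
- rewrite -(quotient_setT K) -!quotientR //.
  by apply/eqP; rewrite -subG1 quotient_sub1.
Qed.

Lemma derived_embedded :
  [~: [~: [set: F], [set: F]], [set: F]]
    \subset pow_group p [~: [set: F], [set: F]].
Proof.
apply: comm_sub_pow => // [|K nK sDK _]; first exact: (der_normal 1).
have subN (X : {set F}) : X \subset 'N(K).
  exact/subset_trans/(normal_norm nK)/subsetT.
have := derived_central pwG (coset_comp_commute nK)
  (coset_comp_gen nK) powerful_derived_embedded.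
rewrite !image_coset_comp -!quotientR // -quotient_setT -!quotientR //.
move=> /(_ (quotient_pow_exp nK sDK)) cD.
apply/(quotient_comm_eq1 nK); rewrite -quotientR //; apply: cD.
(* D is central modulo [K], because [D,F] lies in D^p, hence in (F')^p and in [K]. *)
rewrite quotientR //; apply/(quotient_comm_eq1 nK).
apply: subset_trans weak_comm_group_embedded _.
by apply: subset_trans (pow_groupS _ _) sDK; rewrite commgSS ?subsetT.
Qed.

End Embedded.

(** * Transport along an isomorphism from a finite group *)

Section Transport.
Variables (F : finGroupType) (T : groupType) (f : {multiplicative F -> T}).
Hypothesis f_bij : bijective f.
Implicit Types (A B : set T) (X Y : {set F}).

Let f1 : f 1 = 1. Proof. by apply: (mulgI (f 1)); rewrite -gmulfM !mulg1. Qed.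
Let fV x : f x^-1 = (f x)^-1.
Proof. by apply/esym/mulg1_eq; rewrite -gmulfM mulgV. Qed.
Let f_inj : injective f. Proof. exact: bij_inj. Qed.

Let f_onto y : exists x, y = f x.
Proof. by have [g _ gK] := f_bij; exists (g y); rewrite gK. Qed.

(** Minimality is used twice: the image of [<<X>>] is a subgroup containing [A], and the preimage of
    the subgroup generated by [A] is a group containing [X]. *)
Lemma generated_transport A X :
  (forall x, A (f x) <-> x \in X) ->
  forall x, Defs.generated A (f x) <-> x \in <<X>>.
Proof.
move=> AX x; split.
  move=> gx; have [|y Ay|x' E xX] := generated_min
    (H := fun y => exists2 x, y = f x & x \in <<X>>) _ _ gx.
  - split=> [|_ _ [x1 -> X1] [x2 -> X2]|_ [x1 -> X1]].
    + by exists 1.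
    + by exists (x1 * x2); rewrite ?gmulfM ?groupM.
    + by exists x1^-1; rewrite ?fV ?groupV.
  - by have [x' E] := f_onto y; exists x' => //; apply/mem_gen/AX; rewrite -E.
  by rewrite (f_inj E).
have [g1 gM gV] := generated_subgroup A.
pose P := [set x | `[< Defs.generated A (f x) >]]%SET.
have gP : group_set P.
  apply/group_setP; split=> [|x1 x2]; first by rewrite inE f1; apply/asboolP.
  rewrite !inE => /asboolP X1 /asboolP X2; apply/asboolP.
  by rewrite gmulfM; apply: gM.
suff /subsetP sub : <<X>> \subset P by move/sub; rewrite inE => /asboolP.
rewrite -[P]/(gval (Group gP)) gen_subG; apply/subsetP => y Xy.
by rewrite inE; apply/asboolP; apply: mem_generated; apply/AX.
Qed.

Lemma commutator_transport A B X Y :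
  (forall x, A (f x) <-> x \in X) -> (forall x, B (f x) <-> x \in Y) ->
  forall x, commutator_subgroup A B (f x) <-> x \in [~: X, Y].
Proof.
have fR x y : f [~ x, y] = [~ f x, f y] by rewrite !gmulfM !fV.
move=> AX BY; apply: generated_transport => x; split.
  case=> u0 Au [v0 Bv E]; have [[u Eu] [v Ev]] := (f_onto u0, f_onto v0).
  subst u0 v0; rewrite -fR in E; rewrite -(f_inj E).
  by apply: imset2_f; [apply/AX | apply/BY].
case/imset2P=> u v Xu Yv ->; rewrite fR; exists (f u); first exact/AX.
by exists (f v) => //; apply/BY.
Qed.

Lemma power_transport p A X :
  (forall x, A (f x) <-> x \in X) ->
  forall x, power_subgroup p A (f x) <-> x \in pow_group p X.
Proof.
have fX x n : f (x ^+ n) = f x ^+ n.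
  by elim: n => [//|n IHn]; rewrite !expgS gmulfM IHn.
move=> AX; apply: generated_transport => x; split.
  case=> u0 Au E; have [u Eu] := f_onto u0.
  subst u0; rewrite -fX in E; rewrite -(f_inj E).
  by apply: (imset_f (natexp^~ p)); apply/AX.
by case/imsetP=> u Xu ->; rewrite fX; exists (f u) => //; apply/AX.
Qed.

Lemma powerfully_embedded_transport (p : nat) A (N : {group F}) :
    p.-group [set: F] -> (forall x, Defs.generated A (f x) <-> x \in N) ->
    [~: N, [set: F]] \subset pow_group p N ->
  powerfully_embedded p (Defs.generated A).
Proof.
move=> pF AN pe; split; first by exists F, f.
  exact: generated_subgroup.
move=> y; have [x ->] := f_onto y => Rx.
have allT x' : [set: T]%classic (f x') <-> x' \in [set: F] by rewrite inE.
have Rx' := proj1 (commutator_transport AN allT x) Rx.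
exact: (proj2 (power_transport p AN x) (subsetP pe x Rx')).
Qed.

End Transport.

Lemma powerful_fin (G : finGroupType) (p : nat) :
  powerful G p ->
  p.-group [set: G] /\ [~: [set: G], [set: G]] \subset pow_group p [set: G].
Proof.
move=> [[F [f [f_bij pF]]] pw]; split.
  by rewrite /pgroup cardsT -(bij_eq_card f_bij) -cardsT.
(* [G] is already finite, so its classical and finite subsets are compared along the identity. *)
have id_bij : bijective (idfun : {multiplicative G -> G}) by exists id.
have allT (x : G) : [set: G]%classic (idfun x) <-> x \in [set: G].
  by rewrite inE.
apply/subsetP => x Rx; apply: proj1 (power_transport id_bij p allT x) _.
exact: pw (proj2 (commutator_transport id_bij allT allT x) Rx).
Qed.

Theorem theoremC (p : nat) (G : finGroupType)
  (p_prime : prime p) (p_odd : odd p) (powerful_G : powerful G p) :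
  powerfully_embedded p (chi_derived G) /\ powerfully_embedded p (chi_D G).
Proof.
have [pG pwG] := powerful_fin powerful_G.
have [fin ex] : (exists t : seq (chi G), forall x, x \in t) /\
    (forall x : chi G, exists i, x ^+ (p ^ i) = 1).
  apply: chi_finite_exp p_prime (leqnn _) _ => x; exists (logn p #|[set: G]|).
  by rewrite -card_pgroup // expg_cardG ?inE.
have [F [f [f_bij pF]]] := listed_finite_pgroup p_prime fin ex.
have [g fK gK] := f_bij.
have gM : {morph g : x y / x * y} := can2_gmulfM fK gK.
have g1 : g 1 = 1 by apply: (mulgI (g 1)); rewrite -gM !mulg1.
(* The inverse of [f] is bundled as a morphism, so that the two copies of [G] map into the finite
   group [F]. *)
pose h : UMagmaMorphism.type (chi G) F :=
  HB.pack g (isMultiplicative.Build (chi G) F g gM)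
    (Multiplicative_isUMagmaMorphism.Build (chi G) F g g1).
pose a : UMagmaMorphism.type G F := h \o @chi_g G.
pose b : UMagmaMorphism.type G F := h \o @chi_phi G.
have abR u v : [~ a u, b v] = g [~ chi_g u, chi_phi v].
  by apply: esym (gmulfR h _ _).
have ab_comm x : commute (a x) (b x).
  by rewrite /commute -[LHS]gM -[RHS]gM; congr g; apply: chi_commute.
have ab_gen : <<image_group a :|: image_group b>> = [set: F].
  apply/eqP; rewrite eqEsubset subsetT; apply/subsetP => y _.
  rewrite -[y]fK; elim/chi_ind: (f y) => [|d x w IH].
    by rewrite g1 group1.
  rewrite gM groupM ?IH // mem_gen // inE.
  by case: d; rewrite chi_inE; apply/orP; [right | left];
    apply/imsetP; exists x.
have allT (x : F) : [set: chi G]%classic (f x) <-> x \in [set: F].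
  by rewrite inE.
split.
  apply: (powerfully_embedded_transport f_bij pF
    (commutator_transport f_bij allT allT)).
  exact: derived_embedded p_prime p_odd pG pF pwG ab_comm ab_gen.
apply: (powerfully_embedded_transport f_bij pF
  (N := [~: image_group a, image_group b]%G)); last first.
  exact: weak_comm_group_embedded.
apply: generated_transport => // x; split.
  case=> u _ [v _ E]; rewrite -[x]fK -E -abR.
  by apply: imset2_f; apply: imset_f.
case/imset2P=> _ _ /imsetP[u _ ->] /imsetP[v _ ->] ->.
by rewrite abR gK; exists u => //; exists v.
Qed.
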